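(* A Hausdorff space $X$ is a $\gamma$-space if and only if $\mathcal{S}(X)$ is a $\gamma$-space.
   Context: For a Hausdorff space $X$, $\mathcal{S}(X)$ is the set of all nonempty subsets of $X$ that are unions of finitely many convergent sequences of $X$, where a convergent sequence is understood as a set $\{x_j:j\in\mathbb{N}\}\cup\{x\}$ with $x_j\to x$ in $X$ (trivial, i.e. constant, sequences allowed). $\mathcal{S}(X)$ carries the Vietoris topology, whose basic open sets are $\langle U_1,\dots,U_r\rangle=\{S\in\mathcal{S}(X): S\subset\bigcup_{i=1}^r U_i \text{ and } S\cap U_j\neq\emptyset \text{ for } 1\le j\le r\}$ with $r\in\mathbb{N}$ and $U_1,\dots,U_r$ open in $X$. A space $(Y,\tau)$ is a $\gamma$-space if there exists a function $g:\omega\times Y\to\tau$ such that (i) for each $y\in Y$, $\{g(n,y):n\in\omega\}$ is a base at $y$ and $g(n+1,y)\subset g(n,y)$ for any $n\in\omega$; (ii) for each $n\in\omega$ and $x\in Y$ there exists $m\in\omega$ such that $y\in g(m,x)$ implies $g(m,y)\subset g(n,x)$. *)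

(* Defs.v *)
From HB Require Import structures.
From mathcomp Require Import all_boot all_order all_algebra.
From mathcomp Require Import all_classical.
From mathcomp Require Import topology.

Set Implicit Arguments.
Unset Strict Implicit.
Unset Printing Implicit Defensive.

Local Open Scope classical_set_scope.

Definition convergent_sequence (X : topologicalType) (A : set X) : Prop :=
  exists (u : nat -> X) (x : X), u @ \oo --> x /\ A = range u `|` [set x].

Definition convergent_sequence_unions (X : topologicalType) : set (set X) :=
  [set S | S !=set0 /\
    exists (n : nat) (A : 'I_n -> set X),
      (forall i, convergent_sequence (A i)) /\ S = \bigcup_i A i].

Arguments convergent_sequence_unions : clear implicits.

(* A named copy of the subtype, so that the Vietoris topology below cannot
   compete with the initial topology the library puts on [set_type]. *)
Definition hyperS (X : topologicalType) : Type :=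
  {S : set X | S \in convergent_sequence_unions X}.

HB.instance Definition _ (X : topologicalType) :=
  Choice.copy (hyperS X) {S : set X | S \in convergent_sequence_unions X}.

Definition hyperS_set (X : topologicalType) (S : hyperS X) : set X := sval S.

Coercion hyperS_set : hyperS >-> set.

(* The set <U_0, ..., U_(r-1)>; for r = 0 it is empty, since the elements of
   S(X) are nonempty. *)
Definition vietoris (X : topologicalType) (r : nat) (U : 'I_r -> set X) :
    set (hyperS X) :=
  [set S : hyperS X |
    (S : set X) `<=` \bigcup_i U i /\ forall j, (S : set X) `&` U j !=set0].

(* The topology generated by the base of all <U_0, ..., U_(r-1)>, U_i open. *)
Definition vietoris_open (X : topologicalType) : set_system (hyperS X) :=
  [set O | forall S, O S -> exists (r : nat) (U : 'I_r -> set X),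
    [/\ forall i, open (U i), vietoris U S & vietoris U `<=` O]].

Section vietoris_topology.
Variable X : topologicalType.

Lemma hyperS_nonempty (S : hyperS X) : (S : set X) !=set0.
Proof. by case: S => S /= /set_mem[]. Qed.

Lemma vietoris_openT : @vietoris_open X setT.
Proof.
move=> S _; exists 1%N, (fun=> setT); split=> [i||//]; first exact: openT.
split=> [x _|j]; first by exists ord0.
by rewrite setIT; exact: hyperS_nonempty.
Qed.

Lemma vietoris_openI : setI_closed (@vietoris_open X).
Proof.
move=> P Q oP oQ S [PS QS].
have [r [U [oU [SU US] UP]]] := oP S PS.
have [s [V [oV [SV VS] VQ]]] := oQ S QS.
have oUU : open (\bigcup_i U i) by apply: bigcup_open.
have oVV : open (\bigcup_i V i) by apply: bigcup_open.
pose W (k : 'I_(r + s)) := match fintype.split k with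
  | inl i => U i `&` \bigcup_j V j
  | inr j => V j `&` \bigcup_i U i
  end.
have Wl i : W (lshift s i) = U i `&` \bigcup_j V j.
  by rewrite /W (unsplitK (inl i)).
have Wr j : W (rshift r j) = V j `&` \bigcup_i U i.
  by rewrite /W (unsplitK (inr j)).
exists (r + s)%N, W; split.
- by move=> k; rewrite /W; case: (fintype.split k) => i; apply: openI.
- split=> [x Sx|k].
    have [i _ Ux] := SU x Sx.
    by exists (lshift s i) => //; rewrite Wl; split=> //; exact: SV.
  rewrite /W; case: (fintype.split k) => i.
    by have [x [Sx Ux]] := US i; exists x; split=> //; split=> //; exact: SV.
  by have [x [Sx Vx]] := VS i; exists x; split=> //; split=> //; exact: SU.
- move=> T [TW WT]; split; [apply: UP|apply: VQ]; split=> [x Tx|i].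
  + have [k _] := TW x Tx; rewrite /W.
    by case: (fintype.split k) => i [] // Ux _; exists i.
  + have [x [Tx]] := WT (lshift s i).
    by rewrite Wl => -[Ux _]; exists x.
  + have [k _] := TW x Tx; rewrite /W.
    by case: (fintype.split k) => i [] // Vx _; exists i.
  + have [x [Tx]] := WT (rshift r i).
    by rewrite Wr => -[Vx _]; exists x.
Qed.

Lemma vietoris_open_bigU (I : Type) (f : I -> set (hyperS X)) :
  (forall i, vietoris_open (f i)) -> vietoris_open (\bigcup_i f i).
Proof.
move=> of_ S [i _ fS]; have [r [U [oU US Uf]]] := of_ i S fS.
by exists r, U; split=> // T /Uf fT; exists i.
Qed.

HB.instance Definition _ := isOpenTopological.Build (hyperS X)
  vietoris_openT vietoris_openI vietoris_open_bigU.

Lemma hyperS_openE : (open : set_system (hyperS X)) = @vietoris_open X.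
Proof. by []. Qed.

Lemma vietoris_basis : basis [set O : set (hyperS X) |
  exists (r : nat) (U : 'I_r -> set X), (forall i, open (U i)) /\ O = vietoris U].
Proof.
split=> [_ [r [U [oU ->]]]|S].
  by rewrite hyperS_openE => S SU; exists r, U; split.
move=> P; rewrite nbhsE => -[Q [oQ QS] QP].
have [r [U [oU US UQ]]] := oQ S QS.
exists (vietoris U); first by split=> //; exists r, U.
exact: subset_trans QP.
Qed.

End vietoris_topology.

Definition local_base (Y : topologicalType) (y : Y) (B : set (set Y)) : Prop :=
  B `<=` open_nbhs y /\ forall V, open_nbhs y V -> exists2 W, B W & W `<=` V.

Definition gamma_space (Y : topologicalType) : Prop :=
  exists g : nat -> Y -> set Y,
  [/\ forall n y, open (g n y),
      forall y, local_base y [set g n y | n in [set: nat]] /\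
                forall n, g n.+1 y `<=` g n y
    & forall n x, exists m, forall y, g m x y -> g m y `<=` g n x].

(* Main.v *)
Require Import Defs.
From mathcomp Require Import all_boot all_classical topology.

(** Sending a point to its singleton embeds X into S(X), and being a
    gamma-space passes to subspaces; this is [gamma_space_from_hyperS].

    Conversely, let g be a gamma-function on X.  Call T n-close to S
    ([gamma_close]) when T lies in the union of the g(n,x), x in S, and when
    every s in S lies in some g(n,x), x in S, that T meets.  Since S is compact,
    the sets n-close to S form a Vietoris neighbourhood of S
    ([nbhs_gamma_close]), and G(n,S) is defined to be its interior.  Both
    gamma-space axioms for G then follow from one statement ([gamma_close2]):
    for every open O containing S there is m such that R belongs to O as soon as
    T is m-close to S and R is m-close to T.

    The danger is in the lower half of the Vietoris topology: T may meet a small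
    neighbourhood of a point of S only in isolated points of T, which sets
    close to T are free to avoid.  This is where finite unions of convergent
    sequences come in.  Such an S is compact with finitely many limit points, so
    it is covered by finitely many pairwise disjoint open subsets of X, as fine
    as one likes ([hyperS_compact_disjoint_cover]); hence O contains a
    neighbourhood of S described by such disjoint cells
    ([vietoris_disjoint_cover]).  By a Lebesgue-number argument
    ([gamma_lebesgue]) there is m such that g(m,y) stays within one cell V i
    whenever y lies in g(m,s) for a point s of S in V i.  If a point t of T lies
    in V i and in g(m,x) with x in T, then g(m,x) stays in a single cell, and
    disjointness forces that cell to be V i.  So R, which meets g(m,x), meets
    V i: a step to an m-close set loses no cell
    ([gamma_close_meets_cells]), whether one goes from S to T or from T to R. *)

Set Implicit Arguments.
Unset Strict Implicit.
Unset Printing Implicit Defensive.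

Local Open Scope classical_set_scope.

(** * Convergent sequences and separation *)

(** Tails keep the limit, so that each of them is compact. *)
Definition tail_set (X : Type) (u : nat -> X) (x : X) (j : nat) : set X :=
  [set x] `|` u @` [set i | (j <= i)%N].

Lemma tail_setS (X : Type) (u : nat -> X) (x : X) (j : nat) :
  tail_set u x j = tail_set u x j.+1 `|` [set u j].
Proof.
apply/seteqP; split=> y.
  case=> [->|[i /= ji <-]]; first by left; left.
  move: ji; rewrite leq_eqVlt => /orP[/eqP ->|ji]; first by right.
  by left; right; exists i.
case=> [[->|[i /= ji <-]]| ->]; first by left.
  by right; exists i => //=; exact: ltnW.
by right; exists j => /=.
Qed.

Lemma compact_tail_set (X : topologicalType) (u : nat -> X) (x : X) (j : nat) :
  u @ \oo --> x -> compact (tail_set u x j).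
Proof.
move=> ux; apply/compact_near_coveringP => I F P FF cov.
have [[A B] /= [xA FB] AB] := cov x (or_introl erefl).
(* A neighbourhood of the limit takes care of all but the first J terms. *)
have [J _ JA] : \forall i \near \oo, A (u i) by exact: ux.
have finP : \forall k \near F, forall i : 'I_J, (j <= i)%N -> P k (u i).
  apply: filter_forall => i; have [ji|nji] := pselect (j <= i)%N; last first.
    by apply: nearW => k.
  have [[A' B'] /= [uA FB'] AB'] : \forall x' \near u i & k \near F, P k x'.
    by apply: cov; right; exists i.
  apply: filterS FB' => k B'k _.
  by apply: (AB' (u i, k)); split=> //=; exact: nbhs_singleton.
apply: filterS2 finP FB => k finPk Bk y [->|[i /= ji <-]].
  by apply: (AB (x, k)); split=> //=; exact: nbhs_singleton.
have [iJ|Ji] := ltnP i J; first exact: (finPk (Ordinal iJ)).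
by apply: (AB (u i, k)); split=> //=; exact: JA.
Qed.

(** Each point of K has a neighbourhood missing all small enough neighbourhoods
    U of e; by compactness one U works for the whole of K. *)
Lemma compact_point_separation (X : topologicalType) (K : set X) (e : X) :
  hausdorff_space X -> compact K -> ~ K e ->
  exists O O' : set X,
    [/\ open_nbhs e O, open O', K `<=` O' & O `&` O' = set0].
Proof.
move=> hX /compact_near_coveringP cK nKe.
have covK : forall x, K x ->
    \forall x' \near x & U \near powerset_filter_from (nbhs e), (~` U)° x'.
  move=> x Kx; have /eqP xe : x <> e by move=> xe; apply: nKe; rewrite -xe.
  have := hX; rewrite open_hausdorff => /(_ _ _ xe)[[A B] /= [xA eB] [oA oB AB]].
  exists (A, [set U | U `<=` B]) => /=.
    split; first by apply: open_nbhs_nbhs; split=> //; exact: set_mem.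
    by apply: small_set_sub; apply: open_nbhs_nbhs; split=> //; exact: set_mem.
  move=> [y U] /= [Ay UB].
  apply: filterS (open_nbhs_nbhs (conj oA Ay)) => z Az Uz.
  by suff: set0 z by []; rewrite -(eqP AB); split=> //; exact: UB.
have := cK _ _ _ _ covK.
rewrite near_powerset_filter_fromP => [[U eU KU]|]; last first.
  by move=> U V UV KV x /KV; apply: interiorS; exact: subsetC.
exists U°, (~` U)°; split=> //.
- by split=> //; exact: open_interior.
- exact: open_interior.
- apply/seteqP; split=> // y [/interior_subset Uy /interior_subset].
  exact.
Qed.

(** * Disjoint open covers *)

(** K has a finite disjoint open cover refining the neighbourhood assignment N.
    The set D from which the sizes N x are taken is kept apart from K, so that K
    can be enlarged step by step with D and N fixed. *)
Definition disjoint_cover (X : topologicalType) (N : X -> set X) (D K : set X) :=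
  exists (I : finType) (V : I -> set X),
  [/\ forall i, open (V i), trivIset setT V, K `<=` \bigcup_i V i
    & forall i, exists2 x, D x & V i `<=` N x].

Section disjoint_covers.
Variables (X : topologicalType) (N : X -> set X) (D : set X).
Hypotheses (hX : hausdorff_space X) (oN : forall x, D x -> open_nbhs x (N x)).

Lemma disjoint_cover0 : disjoint_cover N D set0.
Proof. by exists void, (fun=> set0); split=> // -[]. Qed.

(** A new point is separated from the compact set K, which leaves room for one
    more cell once the old cells are shrunk. *)
Lemma disjoint_cover_point (K : set X) (e : X) :
  compact K -> D e -> disjoint_cover N D K -> disjoint_cover N D (K `|` [set e]).
Proof.
move=> cK De [I [V [oV tV KV VN]]].
have [Ke|nKe] := pselect (K e).
  by exists I, V; split=> // x [/KV//| ->]; exact: KV.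
have [O [O' [[oO Oe] oO' KO' OO']]] := compact_point_separation hX cK nKe.
have [oNe Ne] := oN De.
exists (option I), (fun k => if k is Some i then V i `&` O' else N e `&` O).
split.
- by case=> [i|]; exact: openI.
- move=> [i|] [k|] _ _ //=.
  + by move=> [x [[Vi _] [Vk _]]]; rewrite (tV i k) //; exists x.
  + by move=> [x [[_ O'x] [_ Ox]]]; suff: set0 x by []; rewrite -OO'.
  + by move=> [x [[_ Ox] [_ O'x]]]; suff: set0 x by []; rewrite -OO'.
- move=> x [Kx| ->]; last by exists None.
  by have [i _ Vx] := KV x Kx; exists (Some i) => //; split=> //; exact: KO'.
- case=> [i|]; last by exists e => // x [].
  by have [x Dx VNx] := VN i; exists x => // y [/VNx].
Qed.

(** Once the limit is covered, its cell contains a tail of the sequence.  The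
    remaining terms are then added from the last to the first: in this order the
    part already covered is compact at every stage, and only finitely many
    points remain however the cells shrink. *)
Lemma disjoint_cover_sequence (K : set X) (u : nat -> X) (x : X) :
  compact K -> u @ \oo --> x -> tail_set u x 0 `<=` D ->
  disjoint_cover N D K -> disjoint_cover N D (K `|` tail_set u x 0).
Proof.
move=> cK ux uD dK.
have [I [V [oV tV KV VN]]] :=
  disjoint_cover_point cK (uD x (or_introl erefl)) dK.
have [i _ Vx] := KV x (or_intror erefl).
have [J _ JV] : \forall j \near \oo, V i (u j).
  by apply: ux; apply: open_nbhs_nbhs.
have : disjoint_cover N D (K `|` tail_set u x J).
  exists I, V; split=> // y [Ky|[->|[j /= Jj <-]]].
  - by apply: KV; left.
  - by exists i.
  - by exists i => //; exact: JV.
elim: J {JV} => // J IH dJ; apply: IH.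
rewrite tail_setS setUA; apply: disjoint_cover_point => //.
  by apply: compactU => //; exact: compact_tail_set.
by apply: uD; right; exists J.
Qed.

End disjoint_covers.

Lemma convergent_sequence_tail_set (X : topologicalType) (A : set X) :
  convergent_sequence A -> exists (u : nat -> X) (x : X),
    u @ \oo --> x /\ A = tail_set u x 0.
Proof.
move=> [u [x [ux ->]]]; exists u, x; split=> //; rewrite setUC.
by congr (_ `|` _); apply/seteqP; split=> y [i _ <-]; exists i.
Qed.

Lemma compact_disjoint_cover_unions (X : topologicalType) (N : X -> set X)
    (D : set X) (hX : hausdorff_space X)
    (oN : forall x, D x -> open_nbhs x (N x)) (n : nat) (A : 'I_n -> set X) :
  (forall i, convergent_sequence (A i)) -> \bigcup_i A i `<=` D ->
  compact (\bigcup_i A i) /\ disjoint_cover N D (\bigcup_i A i).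
Proof.
elim: n A => [|n IH] A cA AD.
  have -> : \bigcup_i A i = set0 by apply/seteqP; split=> // x [[]].
  by split; [exact: compact0 | exact: disjoint_cover0].
pose B (i : 'I_n) := A (lift ord0 i).
have AE : \bigcup_i A i = \bigcup_i B i `|` A ord0.
  apply/seteqP; split=> x.
    move=> [i _]; case: (unliftP ord0 i) => [j ->|->] Ax; last by right.
    by left; exists j.
  by move=> [[i _ Bx]|Ax]; [exists (lift ord0 i)|exists ord0].
have [u [x [ux A0]]] := convergent_sequence_tail_set (cA ord0).
have [cB dB] : compact (\bigcup_i B i) /\ disjoint_cover N D (\bigcup_i B i).
  apply: IH => [i|y By]; first exact: cA.
  by apply: AD; rewrite AE; left.
rewrite AE A0; split; first by apply: compactU => //; exact: compact_tail_set.
apply: disjoint_cover_sequence => // y uy.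
by apply: AD; rewrite AE A0; right.
Qed.

Lemma hyperS_compact_disjoint_cover (X : topologicalType) (hX : hausdorff_space X)
    (S : hyperS X) (N : X -> set X) :
  (forall x, (S : set X) x -> open_nbhs x (N x)) ->
  compact S /\ disjoint_cover N S S.
Proof.
case: S => S /=; rewrite /hyperS_set /= => SX oN.
have [_ [n [A [cA SA]]]] := set_mem SX.
have := @compact_disjoint_cover_unions X N S hX oN n A cA.
by rewrite -SA; apply.
Qed.

Lemma hyperS_compact (X : topologicalType) (hX : hausdorff_space X)
  (S : hyperS X) : compact S.
Proof.
have [|//] := @hyperS_compact_disjoint_cover X hX S (fun=> setT).
by move=> x _; split=> //; exact: openT.
Qed.

(** For a family V covering S and free of cells that miss S, this says that R lies
    in the Vietoris set of V; cells that miss S impose nothing, so that they need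
    not be discarded. *)
Definition meets_cells (X I : Type) (V : I -> set X) (S R : set X) : Prop :=
  R `<=` \bigcup_i V i /\ forall i, S `&` V i !=set0 -> R `&` V i !=set0.

(** With a point s j of S chosen in each U j, a fine enough cover has the property
    that the cell of s j is contained in U j. *)
Lemma vietoris_disjoint_cover (X : topologicalType) (hX : hausdorff_space X)
    (r : nat) (U : 'I_r -> set X) (S : hyperS X) :
  (forall j, open (U j)) -> vietoris U S ->
  exists (I : finType) (V : I -> set X),
  [/\ forall i, open (V i), trivIset setT V, S `<=` \bigcup_i V i
    & forall R : hyperS X, meets_cells V S R -> vietoris U R].
Proof.
move=> oU [SU US].
have /choice[s sP] : forall j, exists x, (S : set X) x /\ U j x by exact: US.
(* A set N x containing s j can only come from a point x of U j. *)
pose W x j := if `[< U j x >] then U j else ~` [set s j].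
pose N x := \bigcup_j U j `&` [set z | forall j, W x j z].
have oW x j : open (W x j).
  rewrite /W; case: asboolP => // _; rewrite openC.
  by apply: accessible_closed_set1; exact: hausdorff_accessible.
have oN x : (S : set X) x -> open_nbhs x (N x).
  move=> Sx; split.
    apply: openI; first exact: bigcup_open.
    rewrite openE => z Wz; apply: filter_forall => j.
    by apply: open_nbhs_nbhs.
  split; first exact: SU.
  move=> j; rewrite /W; case: asboolP => // nUx xs; apply: nUx; rewrite xs.
  by case: (sP j).
have [_ [I [V [oV tV SV VN]]]] := hyperS_compact_disjoint_cover hX oN.
exists I, V; split=> // R [RV SR]; split.
  by move=> y /RV[i _ Vy]; have [x _ /(_ y Vy)[]] := VN i.
move=> j; have [Ss Us] := sP j; have [i _ Vs] := SV _ Ss.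
have [x _ VNx] := VN i.
have /SR[y [Ry Vy]] : (S : set X) `&` V i !=set0 by exists (s j).
exists y; split=> //; have [_ /(_ j)] := VNx y Vy; have [_ /(_ j)] := VNx _ Vs.
by rewrite /W; case: asboolP => // _ /(_ erefl).
Qed.

(** * Closeness with respect to a gamma-function *)

Section gamma_function.
Variables (X : topologicalType) (g : nat -> X -> set X).
Hypotheses (og : forall n x, open_nbhs x (g n x))
  (gS : forall n x, g n.+1 x `<=` g n x)
  (gbase : forall x V, open_nbhs x V -> exists n, g n x `<=` V)
  (ggamma : forall n x, exists m, forall y, g m x y -> g m y `<=` g n x).

Lemma gamma_mono (m n : nat) (x : X) : (m <= n)%N -> g n x `<=` g m x.
Proof.
elim: n => [|n IH]; first by rewrite leqn0 => /eqP ->.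
rewrite leq_eqVlt => /orP[/eqP ->//|/IH h]; exact: subset_trans h.
Qed.

(** Near a point s of the cell V i, the gamma-property is applied twice: if q
    serves p at s and p serves n at s, with g n s inside V i, then two successive
    steps from any s' in g q s, of index at least p and q, stay in V i. *)
Lemma gamma_lebesgue (K : set X) (I : Type) (V : I -> set X) :
  compact K -> (forall i, open (V i)) -> trivIset setT V ->
  K `<=` \bigcup_i V i ->
  exists m, forall s i, K s -> V i s -> forall y, g m s y -> g m y `<=` V i.
Proof.
move=> /compact_near_coveringP cK oV tV KV.
have covK s : K s -> \forall s' \near s & m \near \oo,
    forall i, V i s' -> forall y, g m s' y -> g m y `<=` V i.
  move=> /KV[i _ Vs].
  have [n nV] := gbase (conj (oV i) Vs).
  have [p pn] := ggamma n s; have [q qp] := ggamma p s.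
  exists (g q s, [set m | (maxn p q <= m)%N]) => /=.
    by split; [exact: (open_nbhs_nbhs (og q s))|exact: nbhs_infty_ge].
  move=> [s' m] /= [gs'] pqm j Vjs' y gy z gz.
  have [pm qm] : (p <= m)%N /\ (q <= m)%N.
    by move: pqm; rewrite geq_max => /andP.
  have gps' : g p s s' by apply: (qp _ gs'); case: (og q s').
  have -> : j = i.
    apply: tV => //; exists s'; split=> //; apply: nV; apply: (pn _ gps').
    by case: (og p s').
  apply: nV; apply: (pn y); last exact: (gamma_mono pm).
  by apply: (qp _ gs'); exact: (gamma_mono qm).
have [m _ mP] := cK _ _ _ _ covK.
by exists m => s i Ks; exact: (mP m (leqnn m) s Ks i).
Qed.

(** The point x in the second clause is in general not s itself: requiring T to
    meet g n s for every s in S would force T to contain the isolated points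
    of S when the sets g n s are singletons there, and T would not range over a
    neighbourhood of S. *)
Definition gamma_close (n : nat) (S T : set X) : Prop :=
  (forall t, T t -> exists2 x, S x & g n x t) /\
  (forall s, S s -> exists x, [/\ S x, g n x s & T `&` g n x !=set0]).

Lemma gamma_closeS n S T : gamma_close n.+1 S T -> gamma_close n S T.
Proof.
move=> [TS ST]; split=> [t /TS[x Sx gx]|s /ST[x [Sx gx [t [Tt gt]]]]].
  by exists x => //; exact: gS.
by exists x; split=> //; [exact: gS|exists t; split=> //; exact: gS].
Qed.

(** A point s of S in V i lies in some g m x that T meets; g m x is contained in
    the cell of x, which contains s and hence is V i. *)
Lemma gamma_close_meets_cells (I : Type) (V : I -> set X) m (S T : set X) :
  trivIset setT V -> S `<=` \bigcup_i V i ->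
  (forall s i, S s -> V i s -> g m s `<=` V i) ->
  gamma_close m S T -> meets_cells V S T.
Proof.
move=> tV SV fV [TS ST]; split.
  move=> t /TS[x Sx gt]; have [i _ Vx] := SV x Sx.
  by exists i => //; exact: (fV x).
move=> i [s [Ss Vs]]; have [x [Sx gs [t [Tt gt]]]] := ST s Ss.
have [j _ Vx] := SV x Sx.
have ij : i = j by apply: tV => //; exists s; split=> //; exact: (fV x).
by exists t; split=> //; rewrite ij; exact: (fV x).
Qed.

(** A finite subcover of S by sets g n x, x in S, spans a basic Vietoris set all
    of whose members are n-close to S. *)
Lemma nbhs_gamma_close (hX : hausdorff_space X) (n : nat) (S : hyperS X) :
  nbhs S [set T : hyperS X | gamma_close n S T].
Proof.
have [_ [I [V [_ _ SV VN]]]] :=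
  hyperS_compact_disjoint_cover hX (fun x (_ : (S : set X) x) => og n x).
have /choice[c cP] : forall i, exists x, (S : set X) x /\ V i `<=` g n x.
  by move=> i; have [x] := VN i; exists x.
pose U (k : 'I_#|I|) := g n (c (enum_val k)).
rewrite nbhsE; exists (vietoris U); last first.
  move=> T [TU UT]; split=> [t /TU[k _ gt]|s /SV[i _ Vs]].
    by exists (c (enum_val k)) => //; case: (cP (enum_val k)).
  have [Sc Vc] := cP i; exists (c i); split=> //; first exact: Vc.
  by have := UT (enum_rank i); rewrite /U enum_rankK.
split.
  rewrite hyperS_openE => T TU; exists #|I|, U; split=> // k.
  by case: (og n (c (enum_val k))).
split=> [s /SV[i _ Vs]|k].
  by exists (enum_rank i) => //; rewrite /U enum_rankK; case: (cP i) => _; apply.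
exists (c (enum_val k)); split; first by case: (cP (enum_val k)).
by case: (og n (c (enum_val k))).
Qed.

(** Since S is close to itself, the case T = S shows that the sets R close to S
    lie in O, so that closeness yields a base at S; taking for O a member of
    this base gives the gamma-property. *)
Lemma gamma_close2 (hX : hausdorff_space X) (S : hyperS X) (O : set (hyperS X)) :
  open_nbhs S O -> exists m, forall T R : hyperS X,
    gamma_close m S T -> gamma_close m T R -> O R.
Proof.
move=> [oO OS]; have [r [U [oU US UO]]] := oO S OS.
have [I [V [oV tV SV VU]]] := vietoris_disjoint_cover hX oU US.
have [m mP] := gamma_lebesgue (@hyperS_compact X hX S) oV tV SV.
exists m => T R ST TR; apply: UO; apply: VU.
have gV s i : (S : set X) s -> V i s -> g m s `<=` V i.
  by move=> Ss Vs; apply: (mP s) => //; case: (og m s).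
have [TV hT] := gamma_close_meets_cells tV SV gV ST.
(* The sets g m t are small at the points of T too, so that the passage from T
   to R can repeat the one from S to T. *)
have gV' t i : (T : set X) t -> V i t -> g m t `<=` V i.
  move=> Tt Vt; have [x Sx gt] := ST.1 t Tt; have [j _ Vx] := SV x Sx.
  have -> : i = j by apply: tV => //; exists t; split=> //; exact: (gV x).
  exact: (mP x).
have [RV hR] := gamma_close_meets_cells tV TV gV' TR.
by split=> // i /hT/hR.
Qed.

End gamma_function.

(** * The equivalence *)

Lemma gamma_space_hyperS (X : topologicalType) (hX : hausdorff_space X) :
  gamma_space X -> gamma_space (hyperS X).
Proof.
move=> [g [og gb gg]].
have og' n x : open_nbhs x (g n x) by apply: (gb x).1.1; exists n.
have gS n x : g n.+1 x `<=` g n x by exact: (gb x).2.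
have gbase x V : open_nbhs x V -> exists n, g n x `<=` V.
  by move=> /((gb x).1.2 V)[_ [n _ <-] ?]; exists n.
pose G n (S : hyperS X) := interior [set T : hyperS X | gamma_close g n S T].
have GS n S : open_nbhs S (G n S).
  by split; [exact: open_interior|exact: nbhs_gamma_close].
have G2 (S : hyperS X) O : open_nbhs S O ->
    exists m, forall T, G m S T -> G m T `<=` O.
  move=> SO; have [m mP] := gamma_close2 og' gS gbase gg hX SO.
  exists m => T /interior_subset ST R /interior_subset TR; exact: mP ST TR.
exists G; split=> [n S|S|n S].
- by case: (GS n S).
- split=> [|n]; last by apply: interiorS => T /=; exact: gamma_closeS.
  split=> [_ [n _ <-]//|O /G2[m mO]].
  by exists (G m S); [exists m|apply: mO; case: (GS m S)].
- exact: G2.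
Qed.

Section singletons.
Variable X : topologicalType.

Lemma convergent_sequence_unions1 (x : X) :
  [set x] \in convergent_sequence_unions X.
Proof.
apply: mem_set; split; first by exists x.
exists 1%N, (fun=> [set x]); split=> [_|]; last first.
  by apply/seteqP; split=> [y xy|y [_ _]//]; exists ord0.
exists (fun=> x), x; split; first exact: cvg_cst.
by apply/seteqP; split=> [y ->|y [[_ _ <-]|]//]; right.
Qed.

Definition hyperS1 (x : X) : hyperS X :=
  exist _ [set x] (convergent_sequence_unions1 x).

Lemma open_hyperS1_preimage (O : set (hyperS X)) :
  open O -> open (hyperS1 @^-1` O).
Proof.
move=> oO; rewrite openE => x Ox; have [r [U [oU [xU Ux] UO]]] := oO _ Ox.
have : nbhs x [set y | forall j, U j y].
  apply: filter_forall => j; apply: open_nbhs_nbhs; split=> //.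
  by have [y [-> ]] := Ux j.
apply: filterS => y Uy; apply: UO; split=> [_ ->|j]; last by exists y.
by have [j _ _] := xU x erefl; exists j.
Qed.

Lemma gamma_space_from_hyperS : gamma_space (hyperS X) -> gamma_space X.
Proof.
move=> [G [oG Gb Gg]].
exists (fun n x => hyperS1 @^-1` G n (hyperS1 x)); split=> [n x|x|n x].
- exact: open_hyperS1_preimage.
- split=> [|n y]; last exact: (Gb _).2.
  split=> [_ [n _ <-]|V [oV Vx]].
    split; first exact: open_hyperS1_preimage.
    by apply: ((Gb (hyperS1 x)).1.1 _ _).2; exists n.
  have VO : open_nbhs (hyperS1 x) (vietoris (fun _ : 'I_1 => V)).
    split; first by rewrite hyperS_openE => S SV; exists 1%N, (fun=> V); split.
    split=> [y xy|_]; first by exists ord0 => //; rewrite xy.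
    by exists x.
  have [_ [n _ <-] GV] := (Gb (hyperS1 x)).1.2 _ VO.
  exists (hyperS1 @^-1` G n (hyperS1 x)); first by exists n.
  by move=> y /GV[_ /(_ ord0)[_ [->]]].
- have [m mP] := Gg n (hyperS1 x); exists m => y /mP GG z; exact: GG.
Qed.

End singletons.

Theorem theorem6p2 (X : topologicalType) (hX : hausdorff_space X) :
  gamma_space X <-> gamma_space (hyperS X).
Proof.
by split; [exact: gamma_space_hyperS|exact: gamma_space_from_hyperS].
Qed.
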